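(* Let $\{X_{i,j},\, i\ge1,\, j\ge1\}$ be a double array of nonnegative integrable random variables satisfying Condition $(H_{2q})$ for some $q\ge1$, let $\{b_n, n\ge1\}$ be an increasing sequence of positive constants, and let $\{\lambda_{m,n,i,j},\,1\le i\le m,\,1\le j\le n,\,m\ge1,\,n\ge1\}$ be an array of positive constants. For $s\ge0$, $m\ge1$, $n\ge1$ (integers), set $$a_{m,n}=\sum_{i=1}^{m}\sum_{j=1}^{n}\lambda_{m,n,i,j},\qquad X_{s,m,n}=X_{m,n}\mathbf{1}\left(X_{m,n}\le b_{2^s}\right)+b_{2^s}\mathbf{1}\left(X_{m,n}>b_{2^s}\right).$$ Then there is a finite constant $C(q)$ depending only on $q$ such that for all $\varepsilon>0$, $m\ge1$, $n\ge1$, $$\begin{aligned} &\mathbb{P}\left(\max_{\substack{1\le u<2^m\\ 1\le v<2^n}}\left|\sum_{i=1}^{u}\sum_{j=1}^{v}(X_{i,j}-\mathbb{E}X_{i,j})\right|\ge 3a_{m,n}\varepsilon\right)\le\sum_{i=1}^{2^m}\sum_{j=1}^{2^n}\mathbb{P}\left(X_{i,j}>b_{2^{m+n}}\right)\\ &\quad+C(q)\varepsilon^{-2q}\sum_{s=1}^{m}\sum_{t=1}^{n}2^{m+n}\lambda_{m,n,s,t}^{-2q}\left(\max_{\substack{1\le i<2^m\\ 1\le j<2^n}}\mathbb{E}X_{s+t,i,j}^{2q}+2^{(s+t)(q-1)}\max_{\substack{1\le i<2^m\\ 1\le j<2^n}}\left(\mathbb{E}X_{s+t,i,j}^{2}\right)^{q}\right),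 \end{aligned}$$ provided that $$\sum_{i=1}^{2^m}\sum_{j=1}^{2^n}\mathbb{E}\left(X_{i,j}\mathbf{1}\left(X_{i,j}>b_{2^{m+n}}\right)\right)\le\varepsilon a_{m,n}$$ and $$6\sum_{s=1}^{m}\sum_{t=1}^{n}2^{s+t}b_{2^{s+t}}\max_{\substack{1\le i<2^m\\ 1\le j<2^n}}\mathbb{P}\left(X_{i,j}>b_{2^{s+t-2}}\right)\le\varepsilon a_{m,n}.$$
   Context: $\mathbf{1}(\cdot)$ is the indicator function. Condition $(H_{2q})$: let $q\ge 1$ be a real number. A family of random variables $\{X_\lambda,\lambda\in\Lambda\}$ (on a common probability space) satisfies Condition $(H_{2q})$ if there is a finite constant $C(q)$ depending only on $q$ (in particular not on $I$ or on the functions $f_\lambda$) such that for every finite subset $I\subset\Lambda$ and every family of increasing functions $f_\lambda:\mathbb{R}\to\mathbb{R}$, $\lambda\in I$, $$\mathbb{E}\left|\sum_{\lambda\in I}\left(f_\lambda(X_\lambda)-\mathbb{E}f_\lambda(X_\lambda)\right)\right|^{2q}\le C(q)\left(|I|\max_{\lambda\in I}\mathbb{E}|f_\lambda(X_\lambda)|^{2q}+|I|^{q}\max_{\lambda\in I}\left(\mathbb{E}f_\lambda^2(X_\lambda)\right)^{q}\right),$$ provided the expectations are finite. Here $|I|$ is the cardinality of $I$. ''Increasing'' is understood in the sense of nondecreasing. The symbol $C(q)$ is a generic constant, not necessarily the same at each appearance; the constant in Condition $(H_{2q})$ counts as depending only on $q$, so the constant in the conclusion depends only on $q$ and on the constant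 in Condition $(H_{2q})$. *)

(* Defs.v *)
From HB Require Import structures.
From mathcomp Require Import all_boot all_order all_algebra finmap.
From mathcomp Require Import all_classical all_reals all_analysis.
Import Order.TTheory GRing.Theory Num.Theory.
Import numFieldNormedType.Exports.

Set Implicit Arguments.
Unset Strict Implicit.
Unset Printing Implicit Defensive.

Local Open Scope classical_set_scope.
Local Open Scope ring_scope.

(* Condition (H_{2q}) for the family {X l, l in A}, with the constant K made
   explicit, so that other constants can be required to depend on it only.
   All maxima are of nonnegative quantities, so 0 is a harmless default value
   (it only matters for empty I, where both sides vanish).
   The three premises on f say that the expectations involved are finite;
   composites with monotone functions are automatically measurable. *)
Definition condition_H2q d (T : measurableType d) (R : realType)
    (P : probability T R) (L : choiceType) (A : set L)
    (X : L -> {RV P >-> R}) (q K : R) : Prop :=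
  forall (I : {fset L}) (f : L -> R -> R),
    [set` I] `<=` A ->
    (forall l, l \in I -> {homo f l : x y / x <= y}) ->
    (forall l, l \in I -> P.-integrable setT (EFin \o (f l \o X l))) ->
    (forall l, l \in I -> ('E_P[fun w => (f l (X l w) ^+ 2)%R] < +oo)%E) ->
    (forall l, l \in I ->
       ('E_P[fun w => (`|f l (X l w)| `^ (2 * q))%R] < +oo)%E) ->
    ('E_P[fun w => (`|\sum_(l <- I)
                       (f l (X l w) - fine 'E_P[f l \o X l])| `^ (2 * q))%R]
     <= K%:E *
        (#|` I|%:R%:E *
           \big[maxe/0]_(l <- I) 'E_P[fun w => (`|f l (X l w)| `^ (2 * q))%R]
         + (#|` I|%:R `^ q)%:E *
           \big[maxe/0]_(l <- I) ('E_P[fun w => (f l (X l w) ^+ 2)%R] `^ q)))%E.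

Definition trunc (R : realType) (c x : R) : R :=
  x * (x <= c)%R%:R + c * (c < x)%R%:R.

Definition lambda_sum (R : realType) (lam : nat -> nat -> nat -> nat -> R)
    (m n : nat) : R :=
  \sum_(1 <= i < m.+1) \sum_(1 <= j < n.+1) lam m n i j.

(* Maximum over 1 <= i < 2^m, 1 <= j < 2^n; only used for nonnegative F and
   m, n >= 1, when the range is nonempty and the default 0 is immaterial. *)
Definition dyadic_max (R : realType) (m n : nat) (F : nat -> nat -> R) : R :=
  \big[Num.max/0]_(1 <= i < 2 ^ m) \big[Num.max/0]_(1 <= j < 2 ^ n) F i j.

Definition dyadic_maxe (R : realType) (m n : nat) (F : nat -> nat -> \bar R)
    : \bar R :=
  (\big[maxe/0]_(1 <= i < 2 ^ m) \big[maxe/0]_(1 <= j < 2 ^ n) F i j)%E.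

(* Main.v *)
Require Import Defs.
From HB Require Import structures.
From mathcomp Require Import all_boot all_order all_algebra finmap.
From mathcomp Require Import all_classical all_reals all_analysis.
From mathcomp Require Import measurable_realfun.
From mathcomp Require Import ring lra zify.
Import Order.TTheory GRing.Theory Num.Theory.
Import numFieldNormedType.Exports.

Local Open Scope classical_set_scope.
Local Open Scope ring_scope.

(** The proof is a chaining argument along dyadic scales, in both indices at
once, with a truncation level that grows with the size of the block.

Write [c r] for [b (2 ^ r)], and [Y r l] for [X l] truncated at [c r].  Off the
event that some [X l] exceeds [c (m + n)], which accounts for the first sum of
the bound, [X] and [Y (m + n)] agree; the first proviso says that replacing the
means of [X] by those of [Y (m + n)] costs at most [eps * a].

Fix [u < 2 ^ m] and [v < 2 ^ n].  The binary expansion of [u] splits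
[{1, ..., u}] into dyadic intervals of distinct lengths [2 ^ s.-1], and likewise
for [v], so that the rectangle of indices splits into dyadic blocks indexed by
[(s, t)].  On block [(s, t)] the variable is truncated at level [s + t] instead
of [m + n].  What is lost is a sum of layers [Y r - Y r.-1 >= 0] with
[s + t < r <= m + n]; raising [s] to [m] and then [t] to [n], each layer is
charged to a larger dyadic block whose scale [(s', t')] satisfies
[s' + t' = r].  Layers being nonnegative, the lost part and its mean are
squeezed between [0] and full block sums.  This gives [chaining_bound], a
deterministic inequality with three terms for each [(s, t)]: a centred block
sum of [Y (s + t)], a centred block sum of layers, and a sum of means of layers.
The means add up to at most [eps * a / 6], by the second proviso.

Both centred sums are sums of nondecreasing functions of the variables, bounded
by [Y (s + t)], over at most [2 ^ (s + t)] indices.  Hence Condition (H_2q) and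
Markov's inequality bound the probability that one of them reaches
[eps * lam s t / 2] ([block_tail]).  There are only
[4 * 2 ^ (m + n - s - t)] blocks to consider at scale [(s, t)], so that a union
bound ([level_tail]) gives the [(s, t)] term of the statement.  If nothing
exceptional happens, the partial sums are below
[eps * a + eps * a + eps * a / 6 < 3 * a * eps]. *)

(** * Dyadic blocks of indices *)

(** Indices start at [1], hence the predecessor: [cell s k] is an interval of
    length [2 ^ s].  It is indexed by [k], the rank of one of its two halves, so
    that one index serves both for [cell] and for [left_cell]. *)
Definition cell (s k i : nat) : bool := (i.-1 %/ 2 ^ s == k %/ 2)%N.

(** The left half of [cell s k] when [k] is the rank of the right half, and
    empty otherwise.  For [k = u %/ 2 ^ s.-1] these are the pieces of
    [{1, ..., u}] given by the binary expansion of [u]. *)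
Definition left_cell (s k i : nat) : bool :=
  cell s k i && (i.-1 %/ 2 ^ s.-1 < k)%N.

(** The level of [i] is the smallest scale at which [i.-1] and [u] lie in the
    same dyadic interval; they lie in the same interval from then on, and only
    at this scale do they lie in different halves of it. *)
Lemma level_exists (m u i : nat) : (0 < i)%N -> (u < 2 ^ m)%N -> (i <= u)%N ->
  exists2 s0, (0 < s0 <= m)%N & forall s, (0 < s)%N ->
    cell s (u %/ 2 ^ s.-1) i = (s0 <= s)%N /\
    left_cell s (u %/ 2 ^ s.-1) i = (s == s0).
Proof.
move=> i0 um iu.
pose same s := (i.-1 %/ 2 ^ s == u %/ 2 ^ s)%N.
have samem : exists s, same s.
  by exists m; rewrite /same !divn_small//; lia.
have samenS s : same s -> same s.+1.
  by rewrite /same !expnSr !divnMA => /eqP ->.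
case: (ex_minnP samem) => s0 s0same s0min.
have sameE s : same s = (s0 <= s)%N.
  apply/idP/idP; first exact: s0min.
  move=> /subnKC <-; elim: (s - s0)%N => [|d IH]; first by rewrite addn0.
  by rewrite addnS; apply: samenS.
have s0_gt0 : (0 < s0)%N.
  by case: s0 s0same {s0min sameE} => //; rewrite /same expn0 !divn1; lia.
exists s0; first by rewrite s0_gt0 s0min// /same !divn_small//; lia.
case=> // s _; have cellE : cell s.+1 (u %/ 2 ^ s) i = same s.+1.
  by rewrite /cell /same -divnMA -expnSr.
rewrite /left_cell cellE sameE /=; split => //.
have -> : (i.-1 %/ 2 ^ s < u %/ 2 ^ s)%N = ~~ same s.
  by rewrite /same ltn_neqAle leq_div2r ?andbT//; lia.
by rewrite sameE; lia.
Qed.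

Lemma left_cell_gt (s u i : nat) : (u < i)%N ->
  left_cell s (u %/ 2 ^ s.-1) i = false.
Proof.
move=> ui; apply/negbTE; rewrite /left_cell negb_and -leqNgt.
by rewrite leq_div2r ?orbT//; lia.
Qed.

Definition box (s t : nat) (k l : nat * nat) : bool :=
  cell s k.1 l.1 && cell t k.2 l.2.

Definition left_box (s t : nat) (k l : nat * nat) : bool :=
  left_cell s k.1 l.1 && left_cell t k.2 l.2.

Definition grid (m n : nat) : seq (nat * nat) :=
  [seq (i, j) | i <- index_iota 1 (2 ^ m), j <- index_iota 1 (2 ^ n)].

Lemma mem_grid (m n : nat) (l : nat * nat) :
  (l \in grid m n) = (1 <= l.1 < 2 ^ m)%N && (1 <= l.2 < 2 ^ n)%N.
Proof.
case: l => i j; rewrite -2!mem_index_iota.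
apply/allpairsP/andP => /=[[[i' j'] /= [? ? [-> ->]]]//|[? ?]].
by exists (i, j).
Qed.

Lemma grid_uniq (m n : nat) : uniq (grid m n).
Proof. by apply: allpairs_uniq; rewrite ?iota_uniq// => -[? ?] [? ?]. Qed.

Lemma count_cell (s k N : nat) :
  (size [seq i <- index_iota 1 N | cell s k i] <= 2 ^ s)%N.
Proof.
rewrite -[leqRHS](size_iota (k %/ 2 * 2 ^ s).+1).
apply: uniq_leq_size; first by rewrite filter_uniq ?iota_uniq.
move=> i; rewrite mem_filter mem_index_iota mem_iota => /andP[/eqP <-].
move=> /andP[i1 _]; have := divn_eq i.-1 (2 ^ s).
have := ltn_pmod i.-1 (expn_gt0 2 s); lia.
Qed.

Lemma count_box (m n s t : nat) (k : nat * nat) :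
  (size [seq l <- grid m n | box s t k l] <= 2 ^ (s + t))%N.
Proof.
rewrite expnD; apply: leq_trans (leq_mul (count_cell s k.1 (2 ^ m))
  (count_cell t k.2 (2 ^ n))).
rewrite -(size_allpairs (@pair nat nat)).
apply: uniq_leq_size; first by rewrite filter_uniq ?grid_uniq.
case=> i j; rewrite mem_filter mem_grid => /andP[/andP[/= ci cj] /andP[iG jG]].
by apply: allpairs_f; rewrite mem_filter mem_index_iota ?ci ?cj.
Qed.

Lemma left_box_box (s t : nat) (k l : nat * nat) :
  left_box s t k l -> box s t k l.
Proof. by rewrite /left_box /box => /andP[/andP[-> _] /andP[-> _]]. Qed.

Lemma count_left_box (m n s t : nat) (k : nat * nat) :
  (size [seq l <- grid m n | left_box s t k l] <= 2 ^ (s + t))%N.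
Proof.
apply: leq_trans (count_box m n s t k); rewrite !size_filter.
by apply: sub_count => l; exact: left_box_box.
Qed.

(** * Chaining *)

(** The path that raises [s0] to [m] and then [t0] to [n] telescopes on the
    left; the right-hand side has all its terms nonnegative and contains those
    of the path. *)
Lemma layer_path_le {R : realType} (y : nat -> R) (m n s0 t0 : nat) :
  (forall r, y r <= y r.+1) -> (s0 <= m)%N -> (t0 <= n)%N ->
  (0 < s0)%N ->
  y (m + n)%N - y (s0 + t0)%N <=
  \sum_(s0 <= s < m.+1) \sum_(t0 <= t < n.+1) (y (s + t)%N - y (s + t).-1).
Proof.
move=> ynd + t0n s00; elim: m => [|m IH]; first by lia.
have g0 r : 0 <= y r - y r.-1.
  by case: r => [|r]; rewrite ?subrr// subr_ge0; exact: ynd.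
rewrite leq_eqVlt => /orP[/eqP s0E|]; last first.
  rewrite ltnS => s0m; rewrite [leRHS]big_nat_recr/=; last by lia.
  rewrite [X in _ <= _ + X]big_nat_recr//=.
  rewrite addSn [in leRHS]/=.
  have := IH s0m; set A := \sum_(_ <= s < m.+1) _; move=> hA.
  have : 0 <= \sum_(t0 <= t < n) (y (m.+1 + t)%N - y (m + t)%N).
    by rewrite sumr_ge0// => t _; exact: (g0 (m.+1 + t)%N).
  lra.
rewrite s0E big_nat1.
rewrite (eq_bigr (fun t => y (m + t.+1)%N - y (m + t)%N)); last first.
  by move=> t _; rewrite addnS addSn.
rewrite (telescope_sumr (fun t => y (m + t)%N)); last exact: leqW.
rewrite addSnnS lerD2l lerN2 addSnnS addnS; exact: ynd.
Qed.

Lemma sum_nat_pick {R : realType} (m s0 : nat) (F : nat -> R) :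
  (0 < s0 <= m)%N ->
  \sum_(1 <= s < m.+1) (s == s0)%:R * F s = F s0.
Proof.
move=> s0m; rewrite (bigD1_seq s0) ?iota_uniq ?mem_index_iota// ?ltnS//=.
rewrite eqxx mul1r big1 ?addr0// => s /negbTE ->; exact: mul0r.
Qed.

(** At a fixed position [l], the cost of replacing the truncation level [m + n]
    by the level of the block that contains [l].  The layers on the path from
    [(s0, t0)], the levels of the two coordinates, to [(m, n)] all belong to
    boxes that contain [l]. *)
Lemma chaining_pointwise {R : realType} (m n u v : nat) (l : nat * nat)
    (y : nat -> R) :
  (u < 2 ^ m)%N -> (v < 2 ^ n)%N -> l \in grid m n ->
  (forall r, y r <= y r.+1) ->
  0 <= ((l.1 <= u)%N && (l.2 <= v)%N)%:R * y (m + n)%N -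
      \sum_(1 <= s < m.+1) \sum_(1 <= t < n.+1)
        (left_box s t (u %/ 2 ^ s.-1, v %/ 2 ^ t.-1)%N l)%:R * y (s + t)%N
    <= \sum_(1 <= s < m.+1) \sum_(1 <= t < n.+1)
        (box s t (u %/ 2 ^ s.-1, v %/ 2 ^ t.-1)%N l)%:R *
          (y (s + t)%N - y (s + t).-1).
Proof.
move=> um vn; rewrite mem_grid => /andP[/andP[l1 _] /andP[l2 _]] ynd.
have g0 r : 0 <= y r - y r.-1.
  by case: r => [|r]; rewrite ?subrr// subr_ge0; exact: ynd.
case: (boolP ((l.1 <= u)%N && (l.2 <= v)%N)) => [/andP[lu lv]|luv]; last first.
  rewrite mul0r big1 ?subrr; last first.
    move=> s _; rewrite big1// => t _; rewrite /left_box.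
    move: luv; rewrite negb_and -!ltnNge => /orP[lu|lv].
      by rewrite left_cell_gt//= mul0r.
    by rewrite [X in _ && X]left_cell_gt// andbF mul0r.
  rewrite lexx/= sumr_ge0// => s _; rewrite sumr_ge0// => t _.
  by rewrite mulr_ge0.
have [s0 s0m s0E] := level_exists _ _ _ l1 um lu.
have [t0 t0n t0E] := level_exists _ _ _ l2 vn lv.
have -> : \sum_(1 <= s < m.+1) \sum_(1 <= t < n.+1)
    (left_box s t (u %/ 2 ^ s.-1, v %/ 2 ^ t.-1)%N l)%:R * y (s + t)%N =
    y (s0 + t0)%N.
  rewrite -(sum_nat_pick _ _ (fun s => y (s + t0)%N) s0m).
  apply: eq_big_nat => s sm.
  rewrite -(sum_nat_pick _ _ (fun t => y (s + t)%N) t0n) big_distrr/=.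
  apply: eq_big_nat => t tn; rewrite /left_box/= (s0E _ _).2; last by lia.
  by rewrite (t0E _ _).2; [rewrite -mulnb natrM mulrA|lia].
rewrite mul1r; apply/andP; split.
  rewrite subr_ge0; apply: (homo_leq (fun x => lexx x) le_trans ynd); lia.
apply: le_trans (layer_path_le _ _ _ _ _ ynd _ _ _) _; [lia..|].
rewrite [X in _ <= X](big_cat_nat _ (n := s0))/=; try by lia.
rewrite -[X in X <= _]add0r lerD//.
  rewrite sumr_ge0// => s _; rewrite sumr_ge0// => t _; rewrite mulr_ge0//.
apply: ler_sum_nat => s sm.
rewrite [X in _ <= X](big_cat_nat _ (n := t0))/=; try by lia.
rewrite -[X in X <= _]add0r lerD//.
  by rewrite sumr_ge0// => t _; rewrite mulr_ge0//.
apply: ler_sum_nat => t tn; rewrite /box/= (s0E _ _).1; last by lia.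
rewrite (t0E _ _).1; last by lia.
by rewrite (_ : (_ <= _)%N && _ = true) ?mul1r//; lia.
Qed.

Lemma sum_rectE {R : realType} (m n u v : nat) (F : nat * nat -> R) :
  (u < 2 ^ m)%N -> (v < 2 ^ n)%N ->
  \sum_(1 <= i < u.+1) \sum_(1 <= j < v.+1) F (i, j) =
  \sum_(l <- grid m n) ((l.1 <= u)%N && (l.2 <= v)%N)%:R * F l.
Proof.
move=> um vn; rewrite big_allpairs_dep/=.
have cut (w N : nat) (G : nat -> R) : (w < N)%N ->
    \sum_(1 <= i < w.+1) G i = \sum_(1 <= i < N) (i <= w)%N%:R * G i.
  move=> wN; rewrite [RHS](big_cat_nat _ (n := w.+1))//=.
  rewrite [X in _ + X]big_nat_cond [X in _ + X]big1 ?addr0; last first.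
    by move=> i; rewrite andbT => /andP[wi _]; rewrite leqNgt wi mul0r.
  by apply: eq_big_nat => i; rewrite ltnS => /andP[_ ->]; rewrite mul1r.
rewrite (cut _ _ _ um); apply: eq_bigr => i _.
rewrite (cut _ _ _ vn) big_distrr/=; apply: eq_bigr => j _.
by rewrite mulrA -natrM mulnb.
Qed.

(** With [y] the truncated variables at some outcome and [e] their means.  The
    losses [rest y] and [rest e] caused by lowering the truncation levels both
    lie between [0] and the full layer sums [incr y] and [incr e], so that their
    difference is at most [`|incr y - incr e| + incr e] in absolute value. *)
Lemma chaining_bound {R : realType} (m n u v : nat)
    (y e : nat -> nat * nat -> R) :
  (u < 2 ^ m)%N -> (v < 2 ^ n)%N ->
  (forall r l, l \in grid m n -> y r l <= y r.+1 l) ->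
  (forall r l, l \in grid m n -> e r l <= e r.+1 l) ->
  `|\sum_(1 <= i < u.+1) \sum_(1 <= j < v.+1)
      (y (m + n)%N (i, j) - e (m + n)%N (i, j))| <=
  \sum_(1 <= s < m.+1) \sum_(1 <= t < n.+1)
    (`|\sum_(l <- grid m n | left_box s t (u %/ 2 ^ s.-1, v %/ 2 ^ t.-1)%N l)
         (y (s + t)%N l - e (s + t)%N l)|
     + `|\sum_(l <- grid m n | box s t (u %/ 2 ^ s.-1, v %/ 2 ^ t.-1)%N l)
          ((y (s + t)%N l - y (s + t).-1 l) - (e (s + t)%N l - e (s + t).-1 l))|
     + \sum_(l <- grid m n | box s t (u %/ 2 ^ s.-1, v %/ 2 ^ t.-1)%N l)
          (e (s + t)%N l - e (s + t).-1 l)).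
Proof.
move=> um vn ynd end_.
pose low (z : nat -> nat * nat -> R) l :=
  \sum_(1 <= s < m.+1) \sum_(1 <= t < n.+1)
    (left_box s t (u %/ 2 ^ s.-1, v %/ 2 ^ t.-1)%N l)%:R * z (s + t)%N l.
pose rest (z : nat -> nat * nat -> R) l :=
  ((l.1 <= u)%N && (l.2 <= v)%N)%:R * z (m + n)%N l - low z l.
pose incr (z : nat -> nat * nat -> R) l :=
  \sum_(1 <= s < m.+1) \sum_(1 <= t < n.+1)
    (box s t (u %/ 2 ^ s.-1, v %/ 2 ^ t.-1)%N l)%:R *
      (z (s + t)%N l - z (s + t).-1 l).
have restP (z : nat -> nat * nat -> R) :
    (forall r l, l \in grid m n -> z r l <= z r.+1 l) ->
    0 <= \sum_(l <- grid m n) rest z l <= \sum_(l <- grid m n) incr z l.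
  move=> znd; have H l : l \in grid m n -> 0 <= rest z l <= incr z l.
    move=> lG; apply: (chaining_pointwise _ _ _ _ _ (fun r => z r l)) => // r.
    exact: znd.
  apply/andP; split.
    by rewrite big_seq sumr_ge0// => l /H/andP[].
  by rewrite big_seq [leRHS]big_seq ler_sum// => l /H/andP[].
have exch (a : nat -> nat -> nat * nat -> bool)
    (F : nat -> nat -> nat * nat -> R) :
    \sum_(l <- grid m n) \sum_(1 <= s < m.+1) \sum_(1 <= t < n.+1)
       (a s t l)%:R * F s t l =
    \sum_(1 <= s < m.+1) \sum_(1 <= t < n.+1)
       \sum_(l <- grid m n | a s t l) F s t l.
  rewrite exchange_big; apply: eq_bigr => s _; rewrite exchange_big.
  apply: eq_bigr => t _; rewrite [RHS]big_mkcond; apply: eq_bigr => l _.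
  by case: (a s t l); rewrite ?mul1r ?mul0r.
rewrite (sum_rectE _ _ _ _ (fun l => y (m + n)%N l - e (m + n)%N l) um vn).
have -> : \sum_(l <- grid m n) ((l.1 <= u)%N && (l.2 <= v)%N)%:R *
      (y (m + n)%N l - e (m + n)%N l) =
    \sum_(l <- grid m n) low (fun r l => y r l - e r l) l +
    (\sum_(l <- grid m n) rest y l - \sum_(l <- grid m n) rest e l).
  rewrite -sumrB -big_split; apply: eq_bigr => l _ /=.
  have -> : low (fun r l => y r l - e r l) l = low y l - low e l.
    rewrite /low -sumrB; apply: eq_bigr => s _; rewrite -sumrB.
    by apply: eq_bigr => t _; rewrite mulrBr.
  by rewrite /rest; ring.
pose A := \sum_(1 <= s < m.+1) \sum_(1 <= t < n.+1)
  `|\sum_(l <- grid m n | left_box s t (u %/ 2 ^ s.-1, v %/ 2 ^ t.-1)%N l)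
         (y (s + t)%N l - e (s + t)%N l)|.
pose B := \sum_(1 <= s < m.+1) \sum_(1 <= t < n.+1)
  `|\sum_(l <- grid m n | box s t (u %/ 2 ^ s.-1, v %/ 2 ^ t.-1)%N l)
      ((y (s + t)%N l - y (s + t).-1 l) - (e (s + t)%N l - e (s + t).-1 l))|.
have lowA : `|\sum_(l <- grid m n) low (fun r l => y r l - e r l) l| <= A.
  rewrite exch; apply: le_trans (ler_norm_sum _ _ _) _.
  by apply: ler_sum => s _; exact: ler_norm_sum.
have incrB : \sum_(l <- grid m n) incr y l - \sum_(l <- grid m n) incr e l <= B.
  rewrite !exch -sumrB; apply: ler_sum => s _; rewrite -sumrB.
  by apply: ler_sum => t _; rewrite -sumrB; exact: ler_norm.
set RHS := (X in _ <= X).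
have -> : RHS = A + B + \sum_(l <- grid m n) incr e l.
  rewrite exch -!big_split; apply: eq_bigr => s _.
  by rewrite -!big_split.
have B0 : 0 <= B.
  by rewrite sumr_ge0// => s _; rewrite sumr_ge0.
have /andP[y0 yi] := restP y ynd; have /andP[e0 ei] := restP e end_.
rewrite -addrA; apply: le_trans (ler_normD _ _) _; rewrite lerD//.
by rewrite ler_norml; apply/andP; split; lra.
Qed.

(** * Truncation and layers *)

Lemma truncE {R : realType} (c x : R) : trunc c x = Num.min x c.
Proof.
rewrite /trunc; case: (lerP x c) => _ /=; last by rewrite mulr0 add0r mulr1.
by rewrite mulr1 mulr0 addr0.
Qed.

Lemma trunc_ge0 {R : realType} (c x : R) : 0 <= c -> 0 <= x -> 0 <= trunc c x.
Proof. by move=> c0 x0; rewrite truncE le_min x0. Qed.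

Lemma trunc_le {R : realType} (c x : R) : trunc c x <= c.
Proof. by rewrite truncE ge_min lexx orbT. Qed.

Lemma trunc_homo {R : realType} (c : R) : {homo trunc c : x y / x <= y}.
Proof. by move=> x y xy; rewrite !truncE le_min2. Qed.

Lemma trunc_level_le {R : realType} (c c' x : R) :
  c' <= c -> trunc c' x <= trunc c x.
Proof. by move=> cc; rewrite !truncE le_min2. Qed.

Definition layer {R : realType} (c' c x : R) : R := trunc c x - trunc c' x.

(** Monotonicity of the layers is what makes Condition (H_2q) apply to them. *)
Lemma layer_homo {R : realType} (c' c : R) :
  c' <= c -> {homo layer c' c : x y / x <= y}.
Proof.
move=> cc x y xy; rewrite /layer !truncE.
by case: (lerP x c); case: (lerP x c'); case: (lerP y c); case: (lerP y c'); lra.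
Qed.

Lemma layer_ge0 {R : realType} (c' c x : R) : c' <= c -> 0 <= layer c' c x.
Proof. by move=> cc; rewrite subr_ge0 trunc_level_le. Qed.

Lemma layer_le_trunc {R : realType} (c' c x : R) :
  0 <= c' -> 0 <= x -> layer c' c x <= trunc c x.
Proof. by move=> c0 x0; rewrite /layer gerBl trunc_ge0. Qed.

Lemma layer_le_indic {R : realType} (c' c x : R) :
  0 <= c' -> c' <= c -> layer c' c x <= c * (c' < x)%R%:R.
Proof.
move=> c0 cc; rewrite /layer !truncE.
by case: (lerP x c); case: (lerP x c') => /=; rewrite ?mulr1 ?mulr0; lra.
Qed.

(** * Probability and expectation *)

Lemma measurable_ge {d} {T : measurableType d} {R : realType}
    (f : T -> R) (c : R) :
  measurable_fun setT f -> measurable [set w | c <= f w].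
Proof.
move=> mf; rewrite (_ : [set _ | _] = f @^-1` `[c, +oo[).
  by rewrite -[X in measurable X]setTI; exact: mf.
by apply/seteqP; split => w /=; rewrite in_itv/= andbT.
Qed.

Lemma measurable_gt {d} {T : measurableType d} {R : realType}
    (f : T -> R) (c : R) :
  measurable_fun setT f -> measurable [set w | c < f w].
Proof.
move=> mf; rewrite (_ : [set _ | _] = f @^-1` `]c, +oo[).
  by rewrite -[X in measurable X]setTI; exact: mf.
by apply/seteqP; split => w /=; rewrite in_itv/= andbT.
Qed.

Lemma probability_cover_le {d} {T : measurableType d} {R : realType}
    (P : probability T R) {I : choiceType} (s : seq I) (A : I -> set T) (E : set T) :
  measurable E -> (forall i, i \in s -> measurable (A i)) ->
  (forall w, E w -> exists2 i, i \in s & A i w) ->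
  (P E <= \sum_(i <- s) P (A i))%E.
Proof.
move=> mE mA EA.
have H (r : seq I) : {subset r <= s} ->
    measurable (\big[setU/set0]_(i <- r) A i) /\
    (P (\big[setU/set0]_(i <- r) A i) <= \sum_(i <- r) P (A i))%E.
  elim: r => [_|i r IH rs]; first by rewrite !big_nil measure0.
  have [|mU PU] := IH; first by move=> j jr; rewrite rs// inE jr orbT.
  have mi : measurable (A i) by apply: mA; apply: rs; rewrite mem_head.
  rewrite !big_cons; split; first exact: measurableU.
  by apply: le_trans (measureU2 _ mi mU) _; rewrite leeD2l.
have [mU] := H s (fun _ => id); apply: le_trans.
apply: le_measure; rewrite ?inE// => w /EA[i si Ai].
by rewrite -bigcup_seq; exists i.
Qed.

Lemma expectation_bounded {d} {T : measurableType d} {R : realType}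
    (P : probability T R) (f : T -> R) (c : R) :
  measurable_fun setT f -> (forall w, 0 <= f w <= c) ->
  P.-integrable setT (EFin \o f) /\
  exists2 r : R, 0 <= r <= c & ('E_P[f] = r%:E)%E.
Proof.
move=> mf f0c.
have If : P.-integrable setT (EFin \o f).
  apply: measurable_bounded_integrable => //.
  exact: (le_lt_trans (probability_le1 P measurableT) (ltry 1)).
exists c; split; first exact: num_real.
  move=> x cx w _ /=; have /andP[f0 fc] := f0c w.
  by rewrite ger0_norm// (le_trans fc)// ltW.
split=> //.
have fE : ('E_P[f])%E \is a fin_num by rewrite unlock integrable_fin_num.
have f0 : (0 <= 'E_P[f])%E by apply: expectation_ge0 => w; case/andP: (f0c w).
have fc : ('E_P[f] <= c%:E)%E.
  rewrite -(expectation_cst P c); apply: expectation_le => //.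
  - by move=> w; case/andP: (f0c w).
  - by move=> w; case/andP: (f0c w); exact: le_trans.
  - by apply: aeW => w; case/andP: (f0c w).
exists (fine 'E_P[f]%E); rewrite ?fineK//.
by rewrite -!lee_fin fineK// f0.
Qed.

Lemma expectation_ge0_le {d} {T : measurableType d} {R : realType}
    (P : probability T R) (f g : T -> R) :
  measurable_fun setT f -> measurable_fun setT g ->
  (forall w, 0 <= f w <= g w) -> ('E_P[f] <= 'E_P[g])%E.
Proof.
move=> mf mg fg; apply: expectation_le => //.
- by move=> w; case/andP: (fg w).
- by move=> w; case/andP: (fg w); exact: le_trans.
- by apply: aeW => w; case/andP: (fg w).
Qed.

(** A layer is at most [c], and vanishes unless the variable exceeds [c']. *)
Lemma expectation_layer {d} {T : measurableType d} {R : realType}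
    (P : probability T R) (f : T -> R) (c' c : R) :
  measurable_fun setT f -> (forall w, 0 <= f w) -> 0 <= c' -> c' <= c ->
  fine 'E_P[layer c' c \o f] =
    fine 'E_P[trunc c \o f] - fine 'E_P[trunc c' \o f] /\
  (0 <= fine 'E_P[layer c' c \o f] <= c * fine (P [set w | c' < f w])).
Proof.
move=> mf f0 c'0 cc; have c0 : 0 <= c by exact: le_trans cc.
have mt x : measurable_fun setT (trunc x \o f).
  apply: measurableT_comp => //; apply: nondecreasing_measurable => // y z.
  exact: trunc_homo.
have tb x : 0 <= x -> forall w, 0 <= (trunc x \o f) w <= x.
  by move=> x0 w; rewrite /= trunc_ge0 ?trunc_le.
have [Ic [r rc rE]] := expectation_bounded P _ c (mt c) (tb c c0).
have [Ic' [r' rc' rE']] := expectation_bounded P _ c' (mt c') (tb c' c'0).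
have lE : ('E_P[layer c' c \o f] = (r - r')%:E)%E.
  rewrite (_ : layer c' c \o f = (trunc c \o f) \- (trunc c' \o f)) //.
  by rewrite expectationB ?rE ?rE'//; exact/Lfun1_integrable.
rewrite lE rE rE' /=; split => //.
have ml : measurable_fun setT (layer c' c \o f).
  apply: measurableT_comp => //; apply: nondecreasing_measurable => // y z.
  exact: layer_homo.
apply/andP; split.
  rewrite -lee_fin -lE; apply: expectation_ge0 => w; exact: layer_ge0.
have mA := measurable_gt _ c' mf.
rewrite -lee_fin -lE EFinM fineK ?fin_num_measure//.
have mi : measurable_fun setT (\1_[set w | c' < f w] : T -> R) by [].
rewrite -(expectation_indic P mA).
rewrite -expectationZl; last first.
  apply/Lfun1_integrable.
  by have [] := expectation_bounded P _ 1 mi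
    (fun w => ltac:(by rewrite indicE; case: (_ \in _); rewrite ?lexx ?ler01)).
apply: expectation_ge0_le => //; first exact: measurable_funM.
move=> w; rewrite layer_ge0//=; apply: le_trans (layer_le_indic _ _ _ c'0 cc) _.
rewrite mulrC indicE mem_setE; exact: lexx.
Qed.

Lemma expectation_trunc_tail {d} {T : measurableType d} {R : realType}
    (P : probability T R) (f : T -> R) (c : R) :
  measurable_fun setT f -> (forall w, 0 <= f w) ->
  P.-integrable setT (EFin \o f) -> 0 <= c ->
  ('E_P[fun w => (f w * (c < f w)%R%:R)%R])%E \is a fin_num /\
  0 <= fine 'E_P[f] - fine 'E_P[trunc c \o f] <=
    fine 'E_P[fun w => (f w * (c < f w)%R%:R)%R].
Proof.
move=> mf f0 intf c0; set g := fun w => _.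
have mt : measurable_fun setT (trunc c \o f).
  apply: measurableT_comp => //; apply: nondecreasing_measurable => // y z.
  exact: trunc_homo.
have mi : measurable_fun setT (\1_[set w | c < f w] : T -> R).
  by apply: measurable_indic; exact: measurable_gt.
have gE : g = f \* \1_[set w | c < f w].
  by apply/funext => w; rewrite /g /= indicE mem_setE.
have mg : measurable_fun setT g by rewrite gE; exact: measurable_funM.
have intg : P.-integrable setT (EFin \o g).
  apply: le_integrable intf => //; first exact/measurable_EFinP.
  move=> w _; rewrite lee_fin /g normrM ler_piMr// ger0_norm ?ler0n//.
  by case: (_ < _).
have [intt _] := expectation_bounded P (trunc c \o f) c mt
  (fun w => introT andP (conj (trunc_ge0 _ _ c0 (f0 w)) (trunc_le c (f w)))).
have fin (h : T -> R) : P.-integrable setT (EFin \o h) ->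
    ('E_P[h])%E \is a fin_num.
  by move=> hI; rewrite unlock integrable_fin_num.
have sub0 w : 0 <= f w - trunc c (f w).
  by rewrite subr_ge0 truncE ge_min lexx.
split; first exact: fin.
rewrite -!lee_fin EFinB !fineK ?fin//.
rewrite -expectationB; [|exact/Lfun1_integrable..].
rewrite expectation_ge0//=; apply: expectation_ge0_le => //.
  exact: measurable_funB.
move=> w; rewrite sub0 /= /g truncE.
case: (lerP (f w) c) => fc; first by rewrite subrr mulr0.
by rewrite mulr1; lra.
Qed.

(** * Dyadic maxima *)

Lemma dyadic_maxe_sup {R : realType} (m n : nat) (F : nat -> nat -> \bar R)
    (l : nat * nat) :
  l \in grid m n -> (F l.1 l.2 <= dyadic_maxe m n F)%E.
Proof.
rewrite mem_grid => /andP[l1 l2].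
apply: (bigmax_sup_seq _ l.1); rewrite ?mem_index_iota//.
by apply: (bigmax_sup_seq _ l.2); rewrite ?mem_index_iota.
Qed.

Lemma dyadic_maxe_bounded {R : realType} (m n : nat) (F : nat -> nat -> \bar R)
    (c : R) : 0 <= c ->
  (forall i j, (1 <= i)%N -> (1 <= j)%N -> (F i j <= c%:E)%E) ->
  exists2 M : R, 0 <= M & dyadic_maxe m n F = M%:E.
Proof.
move=> c0 Fc.
have M0 : (0 <= dyadic_maxe m n F)%E by exact: bigmax_ge_id.
have Mc : (dyadic_maxe m n F <= c%:E)%E.
  rewrite /dyadic_maxe big_nat_cond; apply: bigmax_le => [|i].
    by rewrite lee_fin.
  rewrite andbT => /andP[i1 _].
  rewrite big_nat_cond; apply: bigmax_le => [|j]; rewrite ?lee_fin//.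
  by rewrite andbT => /andP[j1 _]; exact: Fc.
have MF : dyadic_maxe m n F \is a fin_num.
  by rewrite ge0_fin_numE// (le_lt_trans Mc)// ltry.
exists (fine (dyadic_maxe m n F)); last by rewrite fineK.
by rewrite -lee_fin fineK.
Qed.

(** The hypothesis [0 < c] excludes the default value of the maximum. *)
Lemma dyadic_max_ge {R : realType} (m n : nat) (F : nat -> nat -> R) (c : R) :
  0 < c -> c <= dyadic_max m n F ->
  exists u v, [/\ (u < 2 ^ m)%N, (v < 2 ^ n)%N & c <= F u v].
Proof.
move=> c0.
have pick (N : nat) (G : nat -> R) : c <= \big[Num.max/0]_(1 <= i < N) G i ->
    exists2 i, (i < N)%N & c <= G i.
  rewrite big_nat_cond; elim/big_ind: _.
  - by move=> c0'; move: c0; rewrite ltNge c0'.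
  - by move=> x y IHx IHy; rewrite le_max => /orP[/IHx|/IHy].
  - by move=> i /andP[/andP[_ iN] _] ci; exists i.
by move=> /pick[u um] /pick[v vn] cF; exists u, v.
Qed.

Lemma measurable_dyadic_max {d} {T : measurableType d} {R : realType}
    (m n : nat) (F : nat -> nat -> T -> R) :
  (forall i j, (1 <= i)%N -> (1 <= j)%N -> measurable_fun setT (F i j)) ->
  measurable_fun setT (fun w => dyadic_max m n (fun i j => F i j w)).
Proof.
move=> mF.
have H (s : seq nat) (G : nat -> T -> R) :
    (forall i, i \in s -> measurable_fun setT (G i)) ->
    measurable_fun setT (fun w => \big[Num.max/0]_(i <- s) G i w).
  elim: s => [_|i s IH mG]; first by under eq_fun do rewrite big_nil;
    exact: measurable_cst.
  under eq_fun do rewrite big_cons.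
  apply: measurable_maxr; first by apply: mG; rewrite mem_head.
  by apply: IH => j js; apply: mG; rewrite inE js orbT.
apply: (H) => i; rewrite mem_index_iota => /andP[i1 _].
by apply: H => j; rewrite mem_index_iota => /andP[j1 _]; exact: mF.
Qed.

(** * Deviation of block sums *)

Lemma markov_powR {d} {T : measurableType d} {R : realType}
    (P : probability T R) (Z : T -> R) (p x B : R) :
  measurable_fun setT Z -> 0 <= p -> 0 < x ->
  ('E_P[fun w => (`|Z w| `^ p)%R] <= B%:E)%E ->
  (P [set w | (x <= `|Z w|)%R] <= (x `^ (- p) * B)%:E)%E.
Proof.
move=> mZ p0 x0 ZB.
have mem : Z \in mfun by rewrite inE.
have := @markov _ _ _ P (mfun_Sub mem) (fun r => r `^ p) x x0.
have -> : [set w | (x%:E <= `|(mfun_Sub mem w)%:E|)%E] = [set w | x <= `|Z w|].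
  by apply/seteqP; split => w /=; rewrite lee_fin.
move=> H; have {H} : ((x `^ p)%:E * P [set w | (x <= `|Z w|)%R] <= B%:E)%E.
  apply: (le_trans _ ZB); apply: H => //.
  - by move=> *; exact: powR_ge0.
  - exact: ge0_ler_powR.
have mA : measurable [set w | x <= `|Z w|].
  by apply: measurable_ge; exact: measurableT_comp.
rewrite -[P _]fineK ?fin_num_measure// -EFinM !lee_fin powRN => H.
by rewrite ler_pdivlMl// powR_gt0.
Qed.

(** Condition (H_2q) speaks of finite sets, the chaining of filtered lists. *)
Lemma sum_fset_filter {R : realType} (s : seq (nat * nat))
    (p : pred (nat * nat)) :
  uniq s -> exists I : {fset nat * nat},
  [/\ forall l, l \in I -> l \in s, #|` I| = size [seq l <- s | p l] &
   forall F : nat * nat -> R, \sum_(l <- I) F l = \sum_(l <- s | p l) F l].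
Proof.
move=> us; pose I := [fset l in [seq l <- s | p l]]%fset.
have pI : perm_eq I [seq l <- s | p l].
  apply: uniq_perm; rewrite ?fset_uniq ?filter_uniq// => l.
  by rewrite !inE.
exists I; split.
- by move=> l; rewrite (perm_mem pI) mem_filter => /andP[].
- exact: perm_size.
- by move=> F; rewrite -[RHS]big_filter; apply: perm_big.
Qed.

Definition block_dev {d} {T : measurableType d} {R : realType}
    (P : probability T R) (X : nat -> nat -> {RV P >-> R})
    (G : seq (nat * nat)) (p : pred (nat * nat)) (h : R -> R) (w : T) : R :=
  `|\sum_(l <- G | p l)
      (h (X l.1 l.2 w) - fine 'E_P[h \o X l.1 l.2])|.

(** Since [0 <= h <= trunc c] on the nonnegative reals, the moments of [h (X l)]
    that enter Condition (H_2q) are at most those of [trunc c (X l)]; truncation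
    also makes all of them finite. *)
Lemma block_tail {d} {T : measurableType d} {R : realType}
    (P : probability T R) (X : nat -> nat -> {RV P >-> R}) (q K : R)
    (m n N : nat) (p : pred (nat * nat)) (c x M1 M2 : R) (h : R -> R) :
  1 <= q ->
  (forall i j, (1 <= i)%N -> (1 <= j)%N -> forall w, 0 <= X i j w) ->
  condition_H2q [set ij : nat * nat | (1 <= ij.1)%N /\ (1 <= ij.2)%N]
      (fun ij => X ij.1 ij.2) q K ->
  0 <= c -> {homo h : y z / y <= z} ->
  (forall y, 0 <= y -> 0 <= h y <= trunc c y) ->
  (size [seq l <- grid m n | p l] <= N)%N -> 0 <= M1 -> 0 <= M2 ->
  (dyadic_maxe m n (fun i j => 'E_P[fun w => (trunc c (X i j w) `^ (2 * q))%R])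
    = M1%:E)%E ->
  (dyadic_maxe m n (fun i j => 'E_P[fun w => (trunc c (X i j w) ^+ 2)%R] `^ q)
    = M2%:E)%E ->
  0 < x ->
  (P [set w | (x <= block_dev P X (grid m n) p h w)%R] <=
   (x `^ (- (2 * q)) * (`|K| * (N%:R * M1 + N%:R `^ q * M2)))%:E)%E.
Proof.
move=> q1 X0 H2q c0 hh h0 sN M10 M20 M1E M2E x0.
have mh : measurable_fun setT h by exact: nondecreasing_measurable.
have mt : measurable_fun setT (trunc c).
  by apply: nondecreasing_measurable => // y z; exact: trunc_homo.
have mhX l : measurable_fun setT (h \o X l.1 l.2) by exact: measurableT_comp.
have mtX l : measurable_fun setT (trunc c \o X l.1 l.2).
  exact: measurableT_comp.
apply: markov_powR => //; last first.
- have [I [IG Icard Isum]] := @sum_fset_filter R _ p (grid_uniq m n).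
  have Ipos l : l \in I -> (1 <= l.1)%N /\ (1 <= l.2)%N.
    by move/IG; rewrite mem_grid => /andP[/andP[? _] /andP[? _]].
  have hX l : l \in I -> forall w,
      0 <= h (X l.1 l.2 w) <= trunc c (X l.1 l.2 w).
    by move=> /Ipos[l1 l2] w; apply: h0; exact: X0.
  have hXc l : l \in I -> forall w, 0 <= h (X l.1 l.2 w) <= c.
    move=> lI w; have /andP[-> /=] := hX l lI w.
    by move/le_trans; apply; exact: trunc_le.
  have m1 (g : T -> R) : measurable_fun setT g ->
      measurable_fun setT (fun w => `|g w| `^ (2 * q)).
    move=> mg; apply: (measurableT_comp (measurable_powR _)).
    exact: measurableT_comp.
  have m2 (g : T -> R) : measurable_fun setT g ->
      measurable_fun setT (fun w => g w ^+ 2).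
    by move=> mg; exact: measurable_funX.
  have q0 : 0 <= 2 * q by lra.
  under eq_fun do rewrite -Isum.
  apply: le_trans (H2q I (fun _ => h) _ _ _ _ _) _ => //=.
  + by move=> l lI; case: (expectation_bounded P _ c (mhX l) (hXc l lI)).
  + move=> l lI.
    have [] := expectation_bounded P (fun w => h (X l.1 l.2 w) ^+ 2) (c ^+ 2).
    * exact: m2 (mhX l).
    * move=> w; have /andP[h0' hc] := hXc l lI w.
      by rewrite exprn_ge0//= lerXn2r// nnegrE.
    * by move=> _ [r _ ->]; rewrite ltry.
  + move=> l lI.
    have [] := expectation_bounded P
      (fun w => `|h (X l.1 l.2 w)| `^ (2 * q)) (c `^ (2 * q)).
    * exact: m1 (mhX l).
    * move=> w; have /andP[h0' hc] := hXc l lI w.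
      by rewrite powR_ge0 ger0_norm//= ge0_ler_powR// nnegrE.
    * by move=> _ [r _ ->]; rewrite ltry.
  have I1 : (\big[maxe/0]_(l <- I)
      'E_P[fun w => (`|h (X l.1 l.2 w)| `^ (2 * q))%R] <= M1%:E)%E.
    rewrite big_seq; apply: bigmax_le => [|l lI]; first by rewrite lee_fin.
    rewrite -M1E; apply: (le_trans _ (dyadic_maxe_sup _ _ _ _ (IG l lI))).
    apply: expectation_ge0_le; first exact: m1 (mhX l).
      exact: (measurableT_comp (measurable_powR (2 * q)) (mtX l)).
    move=> w; have /andP[h0' ht] := hX l lI w.
    rewrite powR_ge0 ger0_norm//= ge0_ler_powR// nnegrE//.
    exact: (le_trans h0' ht).
  have I2 : (\big[maxe/0]_(l <- I)
      ('E_P[fun w => (h (X l.1 l.2 w) ^+ 2)%R] `^ q) <= M2%:E)%E.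
    rewrite big_seq; apply: bigmax_le => [|l lI]; first by rewrite lee_fin.
    rewrite -M2E; apply: (le_trans _ (dyadic_maxe_sup _ _ _ _ (IG l lI))).
    apply: gt0_ler_poweR; rewrite ?in_itv/=.
    * by lra.
    * by apply/andP; split; rewrite ?leey// expectation_ge0// => w;
        rewrite sqr_ge0.
    * by apply/andP; split; rewrite ?leey// expectation_ge0// => w;
        rewrite sqr_ge0.
    apply: expectation_ge0_le; [exact: m2 (mhX l)|exact: m2 (mtX l)|].
    move=> w; have /andP[h0' ht] := hX l lI w.
    rewrite sqr_ge0 lerXn2r// nnegrE//; exact: (le_trans h0' ht).
  rewrite Icard.
  set S1 := (\big[maxe/0]_(l <- I) _)%E in I1 *.
  set S2 := (\big[maxe/0]_(l <- I) _)%E in I2 *.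
  have S10 : (0 <= S1)%E by exact: bigmax_ge_id.
  have S20 : (0 <= S2)%E by exact: bigmax_ge_id.
  rewrite !EFinM EFinD !EFinM.
  (* [K] may be negative, the bracket may not. *)
  apply: (@le_trans _ _ (`|K|%:E * ((size [seq l <- grid m n | p l])%:R%:E * S1
     + ((size [seq l <- grid m n | p l])%:R `^ q)%:E * S2))%E).
    apply: lee_wpmul2r; last by rewrite lee_fin ler_norm.
    by rewrite adde_ge0// mule_ge0// lee_fin ?powR_ge0.
  apply: lee_wpmul2l; first by rewrite lee_fin.
  apply: leeD; apply: lee_pmul => //; rewrite ?lee_fin ?powR_ge0 ?ler_nat//.
  by rewrite ge0_ler_powR ?nnegrE ?ler_nat//; lra.
- by lra.
- under eq_fun do rewrite -big_filter.
  apply: measurable_sum => l; apply: measurable_funB; first exact: mhX.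
  exact: measurable_cst.
Qed.

Lemma measurable_block_dev {d} {T : measurableType d} {R : realType}
    (P : probability T R) (X : nat -> nat -> {RV P >-> R})
    (G : seq (nat * nat)) (p : pred (nat * nat)) (h : R -> R) (x : R) :
  {homo h : y z / y <= z} ->
  measurable [set w | x <= block_dev P X G p h w].
Proof.
move=> hh; have mh : measurable_fun setT h by exact: nondecreasing_measurable.
have mS : measurable_fun setT (block_dev P X G p h).
  rewrite /block_dev; under eq_fun do rewrite -big_filter.
  apply: measurableT_comp => //; apply: measurable_sum => l.
  apply: measurable_funB; last exact: measurable_cst.
  exact: measurableT_comp.
exact: measurable_ge.
Qed.

(** All the ranks that [(u %/ 2 ^ s.-1, v %/ 2 ^ t.-1)] can take. *)
Definition cells (m n s t : nat) : seq (nat * nat) :=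
  [seq (i, j) | i <- iota 0 (2 ^ (m - s.-1)), j <- iota 0 (2 ^ (n - t.-1))].

Lemma mem_cells (m n s t u v : nat) : (s <= m)%N -> (t <= n)%N ->
  (u < 2 ^ m)%N -> (v < 2 ^ n)%N ->
  ((u %/ 2 ^ s.-1)%N, (v %/ 2 ^ t.-1)%N) \in cells m n s t.
Proof.
move=> sm tn um vn; apply: allpairs_f; rewrite mem_iota add0n.
  by rewrite ltn_divLR ?expn_gt0// -expnD subnK//; lia.
by rewrite ltn_divLR ?expn_gt0// -expnD subnK//; lia.
Qed.

(** The union bound at scale [(s, t)].  The [2 ^ (m - s.-1) * 2 ^ (n - t.-1)]
    blocks contain at most [2 ^ (s + t)] indices each, hence the factor
    [4 * 2 ^ (m + n)]; two families of blocks and the threshold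
    [eps * lam / 2] account for the rest of [8 * 2 `^ (2 * q)]. *)
Lemma level_tail {d} {T : measurableType d} {R : realType}
    (P : probability T R) (X : nat -> nat -> {RV P >-> R}) (q K : R)
    (m n s t : nat) (c' c eps lam : R) :
  1 <= q ->
  (forall i j, (1 <= i)%N -> (1 <= j)%N -> forall w, 0 <= X i j w) ->
  condition_H2q [set ij : nat * nat | (1 <= ij.1)%N /\ (1 <= ij.2)%N]
      (fun ij => X ij.1 ij.2) q K ->
  (1 <= s <= m)%N -> (1 <= t <= n)%N -> 0 <= c' -> c' <= c ->
  0 < eps -> 0 < lam ->
  (\sum_(k <- cells m n s t)
     (P [set w | (eps * lam / 2 <=
                   block_dev P X (grid m n) (left_box s t k) (trunc c) w)%R] +
      P [set w | (eps * lam / 2 <=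
                   block_dev P X (grid m n) (box s t k) (layer c' c) w)%R])
   <= (8 * 2 `^ (2 * q) * `|K| * eps `^ (- (2 * q)))%:E *
      ((2 ^+ (m + n) * lam `^ (- (2 * q)))%:E *
       (dyadic_maxe m n (fun i j => 'E_P[fun w => (trunc c (X i j w) `^ (2 * q))%R])
        + (2 `^ ((s + t)%:R * (q - 1)))%:E *
          dyadic_maxe m n
            (fun i j => 'E_P[fun w => (trunc c (X i j w) ^+ 2)%R] `^ q))))%E.
Proof.
move=> q1 X0 H2q sm tn c'0 cc eps0 lam0.
have c0 : 0 <= c by exact: le_trans cc.
have mt : measurable_fun setT (trunc c).
  by apply: nondecreasing_measurable => // y z; exact: trunc_homo.
have tc i j : (1 <= i)%N -> (1 <= j)%N -> forall w, 0 <= trunc c (X i j w) <= c.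
  by move=> i1 j1 w; rewrite trunc_ge0 ?trunc_le// X0.
have [|M1 M10 M1E] := dyadic_maxe_bounded m n
    (fun i j => 'E_P[fun w => (trunc c (X i j w) `^ (2 * q))%R]%E)
    (c `^ (2 * q)) (powR_ge0 _ _).
  move=> i j i1 j1.
  have [||_ [r /andP[_ rc] ->]] := expectation_bounded P
      (fun w => trunc c (X i j w) `^ (2 * q)) (c `^ (2 * q)).
  - apply: (measurableT_comp (measurable_powR (2 * q))).
    exact: measurableT_comp.
  - move=> w; have /andP[t0 tle] := tc i j i1 j1 w.
    by rewrite powR_ge0 ge0_ler_powR ?nnegrE//; lra.
  - by rewrite lee_fin.
have [|M2 M20 M2E] := dyadic_maxe_bounded m n
    (fun i j => 'E_P[fun w => (trunc c (X i j w) ^+ 2)%R] `^ q)%E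
    ((c ^+ 2) `^ q) (powR_ge0 _ _).
  move=> i j i1 j1.
  have [||_ [r /andP[r0 rc] ->]] := expectation_bounded P
      (fun w => trunc c (X i j w) ^+ 2) (c ^+ 2).
  - by apply: measurable_funX; exact: measurableT_comp.
  - move=> w; have /andP[t0 tle] := tc i j i1 j1 w.
    by rewrite sqr_ge0 lerXn2r ?nnegrE.
  - rewrite poweR_EFin lee_fin ge0_ler_powR ?nnegrE ?sqr_ge0//; lra.
rewrite M1E M2E.
set x := eps * lam / 2; have x0 : 0 < x by rewrite /x divr_gt0 ?mulr_gt0.
pose N := (2 ^ (s + t))%N.
set bnd := (x `^ (- (2 * q)) * (`|K| * (N%:R * M1 + N%:R `^ q * M2))).
have tail (k : nat * nat) :
   (P [set w | (x <= block_dev P X (grid m n) (left_box s t k) (trunc c) w)%R] +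
    P [set w | (x <= block_dev P X (grid m n) (box s t k) (layer c' c) w)%R]
    <= (bnd + bnd)%:E)%E.
  rewrite EFinD; apply: leeD; apply: (@block_tail _ _ _ P X q K m n N _ c) => //.
  - exact: trunc_homo.
  - by move=> y y0; rewrite trunc_ge0 ?lexx.
  - exact: count_left_box.
  - exact: layer_homo.
  - by move=> y y0; rewrite layer_ge0 ?layer_le_trunc.
  - exact: count_box.
apply: (le_trans (lee_sum _ (fun k _ => tail k))).
rewrite sumEFin -!EFinM lee_fin.
rewrite big_const_seq count_predT iter_addr_0 size_allpairs !size_iota.
rewrite -mulr_natl.
have WN : (2 ^ (m - s.-1) * 2 ^ (n - t.-1))%:R * N%:R = 4 * 2 ^+ (m + n) :> R.
  rewrite -natrM /N -!expnD.
  rewrite (_ : (_ + (s + t))%N = (2 + (m + n))%N); last by lia.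
  by rewrite expnD natrM [X in _ * X]natrX.
have NE : N%:R = 2 `^ (s + t)%:R :> R by rewrite /N natrX powR_mulrn.
have Nq : N%:R `^ q = N%:R * 2 `^ ((s + t)%:R * (q - 1)) :> R.
  rewrite NE -powRrM -powRD; last by apply/implyP.
  by congr (_ `^ _); ring.
have xE : x `^ (- (2 * q)) =
    eps `^ (- (2 * q)) * lam `^ (- (2 * q)) * 2 `^ (2 * q).
  rewrite /x !powRM ?mulr_ge0 ?invr_ge0 ?ltW//; congr (_ * _).
  by rewrite -powR_inv1// -powRrM mulN1r opprK.
rewrite /bnd Nq xE le_eqVlt; apply/orP; left; apply/eqP.
move: WN; set W : R := (2 ^ (m - s.-1) * 2 ^ (n - t.-1))%:R => WN.
set e1 := eps `^ _; set l1 := lam `^ _; set p2 := 2 `^ (2 * q).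
set M := 2 `^ ((s + t)%:R * _).
transitivity (W * N%:R * (2 * e1 * l1 * p2 * `|K| * (M1 + M * M2))).
  by ring.
by rewrite WN; ring.
Qed.

(** * The maximal inequality *)

Lemma ler_sum_rect {R : realType} (u v M N : nat) (F G : nat -> nat -> R) :
  (u <= M)%N -> (v <= N)%N ->
  (forall i j, (1 <= i)%N -> (1 <= j)%N -> 0 <= F i j <= G i j) ->
  \sum_(1 <= i < u.+1) \sum_(1 <= j < v.+1) F i j <=
  \sum_(1 <= i < M.+1) \sum_(1 <= j < N.+1) G i j.
Proof.
move=> uM vN FG.
have G0 i j : (1 <= i)%N -> (1 <= j)%N -> 0 <= G i j.
  by move=> i1 j1; have /andP[] := FG i j i1 j1; exact: le_trans.
rewrite [leRHS](big_cat_nat _ (n := u.+1))//= -[leLHS]addr0 lerD//; last first.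
  rewrite big_nat sumr_ge0// => i iM; rewrite big_nat sumr_ge0// => j jN.
  by apply: G0; lia.
apply: ler_sum_nat => i /andP[i1 _].
rewrite [leRHS](big_cat_nat _ (n := v.+1))//= -[leLHS]addr0 lerD//; last first.
  by rewrite big_nat sumr_ge0// => j jN; apply: G0; lia.
by apply: ler_sum_nat => j /andP[j1 _]; have /andP[] := FG i j i1 j1.
Qed.

Lemma sum_layer_means {R : realType} (m n u v : nat)
    (g : nat -> nat -> nat * nat -> R) (B : nat -> nat -> R) :
  (forall s t l, (1 <= s)%N -> (1 <= t)%N -> l \in grid m n ->
     g s t l <= B s t) ->
  (forall s t, 0 <= B s t) ->
  \sum_(1 <= s < m.+1) \sum_(1 <= t < n.+1)
    \sum_(l <- grid m n | box s t (u %/ 2 ^ s.-1, v %/ 2 ^ t.-1)%N l) g s t l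
  <= \sum_(1 <= s < m.+1) \sum_(1 <= t < n.+1) 2 ^+ (s + t) * B s t.
Proof.
move=> gB B0; apply: ler_sum_nat => s sm; apply: ler_sum_nat => t tn.
rewrite big_seq_cond.
apply: (@le_trans _ _ (\sum_(l <- grid m n |
    (l \in grid m n) && box s t (u %/ 2 ^ s.-1, v %/ 2 ^ t.-1)%N l) B s t)).
  by apply: ler_sum => l /andP[lG _]; apply: gB => //; lia.
rewrite -big_seq_cond -big_filter big_const_seq count_predT iter_addr_0.
rewrite -[leLHS]mulr_natl -natrX; apply: ler_wpM2r => //.
by rewrite ler_nat; exact: count_box.
Qed.

Theorem theorem2p2 (R : realType) (q K : R) (hq : 1 <= q) :
  exists C : R,
  forall (d : measure_display) (T : measurableType d) (P : probability T R)
    (X : nat -> nat -> {RV P >-> R})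
    (b : nat -> R) (lam : nat -> nat -> nat -> nat -> R),
    (forall i j, (1 <= i)%N -> (1 <= j)%N -> forall w, 0 <= X i j w) ->
    (forall i j, (1 <= i)%N -> (1 <= j)%N ->
       P.-integrable setT (EFin \o X i j)) ->
    condition_H2q [set ij : nat * nat | (1 <= ij.1)%N /\ (1 <= ij.2)%N]
      (fun ij => X ij.1 ij.2) q K ->
    (forall k, (1 <= k)%N -> 0 < b k) ->
    (forall k l, (1 <= k)%N -> (k <= l)%N -> b k <= b l) ->
    (forall m n i j, (1 <= i <= m)%N -> (1 <= j <= n)%N -> 0 < lam m n i j) ->
    forall (eps : R) (m n : nat), 0 < eps -> (1 <= m)%N -> (1 <= n)%N ->
    (\sum_(1 <= i < (2 ^ m).+1) \sum_(1 <= j < (2 ^ n).+1)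
       'E_P[fun w => (X i j w * (b (2 ^ (m + n))%N < X i j w)%R%:R)%R]
     <= (eps * lambda_sum lam m n)%:E)%E ->
    (6%:E * \sum_(1 <= s < m.+1) \sum_(1 <= t < n.+1)
       (2 ^+ (s + t) * b (2 ^ (s + t))%N)%:E *
         dyadic_maxe m n
           (fun i j => P [set w | (b (2 ^ (s + t - 2))%N < X i j w)%R])
     <= (eps * lambda_sum lam m n)%:E)%E ->
    (P [set w | (3 * lambda_sum lam m n * eps <=
          dyadic_max m n (fun u v =>
            `|\sum_(1 <= i < u.+1) \sum_(1 <= j < v.+1)
                (X i j w - fine 'E_P[X i j])|))%R]
     <= \sum_(1 <= i < (2 ^ m).+1) \sum_(1 <= j < (2 ^ n).+1)
          P [set w | (b (2 ^ (m + n))%N < X i j w)%R]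
        + (C * eps `^ (- (2 * q)))%:E *
          \sum_(1 <= s < m.+1) \sum_(1 <= t < n.+1)
            (2 ^+ (m + n) * lam m n s t `^ (- (2 * q)))%:E *
            (dyadic_maxe m n (fun i j =>
               'E_P[fun w => (trunc (b (2 ^ (s + t))%N) (X i j w) `^ (2 * q))%R])
             + (2 `^ ((s + t)%:R * (q - 1)))%:E *
               dyadic_maxe m n (fun i j =>
                 'E_P[fun w => (trunc (b (2 ^ (s + t))%N) (X i j w) ^+ 2)%R]
                   `^ q)))%E.
Proof.
exists (8 * 2 `^ (2 * q) * `|K|).
move=> d T P X b lam X0 Xint H2q b0 bmono lam0 eps m n eps0 m1 n1 cond1 cond2.
pose c r := b (2 ^ r)%N.
have c_gt0 r : 0 < c r by rewrite b0// expn_gt0.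
have c_ge0 r : 0 <= c r by exact: ltW.
have c_le r r' : (r <= r')%N -> c r <= c r'.
  by move=> rr; rewrite bmono ?expn_gt0// leq_pexp2l.
pose y r l w := trunc (c r) (X l.1 l.2 w).
pose e r (l : nat * nat) : R := fine 'E_P[trunc (c r) \o X l.1 l.2].
pose x s t := eps * lam m n s t / 2.
pose A s t k := block_dev P X (grid m n) (left_box s t k) (trunc (c (s + t)%N)).
pose B s t k :=
  block_dev P X (grid m n) (box s t k) (layer (c (s + t).-1) (c (s + t)%N)).
set a := lambda_sum lam m n.
have a_gt0 : 0 < a.
  have l0 i j : (1 <= i <= m)%N -> (1 <= j <= n)%N -> 0 <= lam m n i j.
    by move=> im jn; rewrite ltW// lam0.
  rewrite /a /lambda_sum big_ltn// ltr_wpDr//; last first.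
    rewrite big_ltn// ltr_wpDr// ?lam0//.
    by rewrite big_nat sumr_ge0// => j jn; rewrite l0//; lia.
  rewrite big_nat sumr_ge0// => i im; rewrite big_nat sumr_ge0// => j jn.
  by rewrite l0//; lia.
have gridX l : l \in grid m n -> forall w, 0 <= X l.1 l.2 w.
  by rewrite mem_grid => /andP[/andP[l1 _] /andP[l2 _]]; exact: X0.
have layerE l r r' : l \in grid m n -> (r' <= r)%N ->
    fine 'E_P[layer (c r') (c r) \o X l.1 l.2] = e r l - e r' l /\
    0 <= e r l - e r' l <= c r * fine (P [set w | c r' < X l.1 l.2 w]).
  move=> lG rr; have mX : measurable_fun setT (X l.1 l.2) by [].
  have [<- H] := expectation_layer P _ _ _ mX (gridX l lG) (c_ge0 r')
    (c_le _ _ rr).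
  by split.
have y_nd w r l : l \in grid m n -> y r l w <= y r.+1 l w.
  by move=> _; rewrite /y trunc_level_le// c_le.
have e_nd r l : l \in grid m n -> e r l <= e r.+1 l.
  move=> lG; have [_ /andP[+ _]] := layerE l r.+1 r lG (leqnSn r).
  by rewrite subr_ge0.
have tailE i j : (1 <= i)%N -> (1 <= j)%N ->
    ('E_P[fun w => (X i j w * (c (m + n) < X i j w)%R%:R)%R])%E \is a fin_num /\
    0 <= fine 'E_P[X i j] - e (m + n)%N (i, j) <=
      fine 'E_P[fun w => (X i j w * (c (m + n)%N < X i j w)%R%:R)%R].
  move=> i1 j1; apply: expectation_trunc_tail => //; [exact: X0|exact: Xint].
pose tl i j := fine 'E_P[fun w => (X i j w * (c (m + n)%N < X i j w)%R%:R)%R].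
have tail_sum : \sum_(1 <= i < (2 ^ m).+1) \sum_(1 <= j < (2 ^ n).+1) tl i j
    <= eps * a.
  rewrite -lee_fin; apply: le_trans cond1; rewrite le_eqVlt; apply/orP; left.
  apply/eqP; rewrite -sumEFin; apply: eq_big_nat => i /andP[i1 _].
  rewrite -sumEFin; apply: eq_big_nat => j /andP[j1 _].
  by rewrite fineK//; case: (tailE i j i1 j1).
pose Pm s t := fine (dyadic_maxe m n
  (fun i j => P [set w | (b (2 ^ (s + t - 2))%N < X i j w)%R])).
have mlev i j z : measurable [set w | z < X i j w].
  by apply: measurable_gt.
have PmE s t : dyadic_maxe m n
    (fun i j => P [set w | (b (2 ^ (s + t - 2))%N < X i j w)%R]) = (Pm s t)%:E.
  have [|M M0 ME] := dyadic_maxe_bounded m n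
    (fun i j => P [set w | (b (2 ^ (s + t - 2))%N < X i j w)%R]) 1 ler01.
    by move=> i j _ _; exact: probability_le1.
  by rewrite /Pm ME.
have Pm_ge0 s t : 0 <= Pm s t.
  by rewrite -lee_fin -PmE; exact: bigmax_ge_id.
have layer_mean s t l : (1 <= s)%N -> (1 <= t)%N -> l \in grid m n ->
    e (s + t)%N l - e (s + t).-1 l <= c (s + t)%N * Pm s t.
  move=> s1 t1 lG; have [_ /andP[_ le1]] := layerE l _ _ lG (leq_pred (s + t)).
  apply: (le_trans le1); apply: ler_wpM2l => //.
  rewrite -lee_fin -PmE fineK ?fin_num_measure//.
  apply: (le_trans _ (dyadic_maxe_sup _ _ _ _ lG)).
  apply: le_measure; rewrite ?inE//; try exact: mlev.
  move=> w /=; apply: le_lt_trans; apply: (c_le (s + t - 2)%N); lia.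
have mean_sum u v : \sum_(1 <= s < m.+1) \sum_(1 <= t < n.+1)
    \sum_(l <- grid m n | box s t (u %/ 2 ^ s.-1, v %/ 2 ^ t.-1)%N l)
      (e (s + t)%N l - e (s + t).-1 l) <= eps * a / 6.
  apply: le_trans (sum_layer_means m n u v _ _ layer_mean _) _.
    by move=> s t; rewrite mulr_ge0.
  rewrite ler_pdivlMr// mulrC -lee_fin; apply: le_trans cond2.
  rewrite le_eqVlt; apply/orP; left; apply/eqP.
  rewrite EFinM; congr (_ * _)%E.
  rewrite -sumEFin; apply: eq_bigr => s _; rewrite -sumEFin.
  by apply: eq_bigr => t _; rewrite PmE mulrA EFinM.
(* No exceptional event at [w]: the three contributions stay below
   [eps * a + (eps * a + eps * a / 6) < 3 * a * eps]. *)
have path w u v : (u < 2 ^ m)%N -> (v < 2 ^ n)%N ->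
    (forall i j, (1 <= i <= 2 ^ m)%N -> (1 <= j <= 2 ^ n)%N ->
       X i j w <= c (m + n)%N) ->
    (forall s t k, (1 <= s <= m)%N -> (1 <= t <= n)%N ->
       k \in cells m n s t -> A s t k w < x s t /\ B s t k w < x s t) ->
    `|\sum_(1 <= i < u.+1) \sum_(1 <= j < v.+1)
        (X i j w - fine 'E_P[X i j])| < 3 * a * eps.
  move=> um vn Xc AB.
  pose D : R := \sum_(1 <= i < u.+1) \sum_(1 <= j < v.+1)
    (fine 'E_P[X i j] - e (m + n)%N (i, j)).
  have D0 : 0 <= D <= eps * a.
    apply/andP; split.
      rewrite /D big_nat sumr_ge0// => i /andP[i1 _].
      rewrite big_nat sumr_ge0// => j /andP[j1 _].
      by have [_ /andP[]] := tailE i j i1 j1.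
    apply: (le_trans _ tail_sum); apply: ler_sum_rect; try exact: ltnW.
    by move=> i j i1 j1; have [] := tailE i j i1 j1.
  have -> : \sum_(1 <= i < u.+1) \sum_(1 <= j < v.+1)
        (X i j w - fine 'E_P[X i j]) =
      \sum_(1 <= i < u.+1) \sum_(1 <= j < v.+1)
        (y (m + n)%N (i, j) w - e (m + n)%N (i, j)) - D.
    rewrite /D -sumrB; apply: eq_big_nat => i iu; rewrite -sumrB.
    apply: eq_big_nat => j jv.
    by rewrite /y truncE min_l; [ring|apply: Xc => /=; lia].
  have := chaining_bound m n u v (fun r l => y r l w) e um vn (y_nd w) e_nd.
  set S := \sum_(1 <= i < u.+1) _ => Sle.
  have {Sle} : `|S| <= eps * a + eps * a / 6.
    apply: (le_trans Sle).
    apply: (le_trans _ (lerD (lexx _) (mean_sum u v))).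
    rewrite /a /lambda_sum big_distrr -big_split/=; apply: ler_sum_nat => s sm.
    rewrite big_distrr -big_split/=; apply: ler_sum_nat => t tn.
    rewrite lerD2r.
    have [] := AB s t _ sm tn (mem_cells m n s t u v _ _ um vn); [lia|lia|].
    rewrite /A /B /block_dev /x => A1.
    set b1 := \sum_(l <- _ | box _ _ _ _) _.
    set b2 := \sum_(l <- _ | box _ _ _ _) _.
    have -> : b1 = b2.
      rewrite /b1 /b2 big_seq_cond [RHS]big_seq_cond.
      apply: eq_bigr => l /andP[lG _].
      by have [-> _] := layerE l _ _ lG (leq_pred (s + t)).
    move=> B1; apply: le_trans (lerD (ltW A1) (ltW B1)) _.
    lra.
  have /andP[D1 D2] := D0.
  have ea : 0 < eps * a by rewrite mulr_gt0.
  rewrite ler_norml ltr_norml => /andP[S1 S2]; apply/andP; split; lra.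
(* The exceptional events: [inl l] is a large value of [X l], and [inr (st, k)]
   a large deviation of one of the two sums over block [k] at scale [st]. *)
pose exceed := [seq (i, j) | i <- index_iota 1 (2 ^ m).+1,
                            j <- index_iota 1 (2 ^ n).+1].
pose levels := [seq (s, t) | s <- index_iota 1 m.+1, t <- index_iota 1 n.+1].
pose idx := [seq (st, k) | st <- levels, k <- cells m n st.1 st.2].
pose bad (z : (nat * nat) + (nat * nat) * (nat * nat)) : set T :=
  match z with
  | inl l => [set w | c (m + n)%N < X l.1 l.2 w]
  | inr (st, k) => [set w | x st.1 st.2 <= A st.1 st.2 k w] `|`
                   [set w | x st.1 st.2 <= B st.1 st.2 k w]
  end.
have mA s t k : measurable [set w | x s t <= A s t k w].
  by apply: measurable_block_dev; exact: trunc_homo.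
have mB s t k : measurable [set w | x s t <= B s t k w].
  by apply: measurable_block_dev; apply: layer_homo; rewrite c_le// leq_pred.
have mbad z : measurable (bad z).
  case: z => [l|[st k]]; first exact: mlev.
  exact: measurableU.
set E := [set w | _].
have mE : measurable E.
  pose F u v w := `|\sum_(1 <= i < u.+1) \sum_(1 <= j < v.+1)
                (X i j w - fine 'E_P[X i j])|.
  have mF : measurable_fun setT (fun w => dyadic_max m n (fun u v => F u v w)).
    apply: measurable_dyadic_max => u v _ _.
    apply: measurableT_comp => //; apply: measurable_sum => i.
    apply: measurable_sum => j; apply: measurable_funB => //.
  exact: measurable_ge.
have Ebad w : E w -> exists2 z, z \in map inl exceed ++ map inr idx & bad z w.
  move=> Ew; apply: contrapT => nbad.
  have [|u [v [um vn]]] := dyadic_max_ge m n _ (3 * a * eps) _ Ew.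
    by rewrite !mulr_gt0.
  apply/negP; rewrite -ltNge; apply: path => //.
    move=> i j im jn; rewrite leNgt; apply/negP => Xij; apply: nbad.
    exists (inl (i, j)); last exact: Xij.
    by rewrite mem_cat map_f//; apply: allpairs_f; rewrite mem_index_iota.
  move=> s t k sm tn kc; rewrite !ltNge; split; apply/negP => H; apply: nbad.
    exists (inr ((s, t), k)); last by left.
    rewrite mem_cat; apply/orP; right; apply: map_f.
    apply/allpairsPdep; exists (s, t), k; split => //.
    by apply: allpairs_f; rewrite mem_index_iota.
  exists (inr ((s, t), k)); last by right.
  rewrite mem_cat; apply/orP; right; apply: map_f.
  apply/allpairsPdep; exists (s, t), k; split => //.
  by apply: allpairs_f; rewrite mem_index_iota.
apply: (le_trans (probability_cover_le P _ bad E mE (fun z _ => mbad z) Ebad)).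
rewrite big_cat !big_map /=; apply: leeD.
  by rewrite big_allpairs_dep.
rewrite big_allpairs_dep/= big_allpairs_dep/=.
have term_ge0 s t : (0 <= (2 ^+ (m + n) * lam m n s t `^ (- (2 * q)))%:E *
    (dyadic_maxe m n (fun i j =>
       'E_P[fun w => (trunc (b (2 ^ (s + t))%N) (X i j w) `^ (2 * q))%R])
     + (2 `^ ((s + t)%:R * (q - 1)))%:E *
       dyadic_maxe m n (fun i j =>
         'E_P[fun w => (trunc (b (2 ^ (s + t))%N) (X i j w) ^+ 2)%R] `^ q)))%E.
  apply: mule_ge0; first by rewrite lee_fin mulr_ge0 ?powR_ge0 ?exprn_ge0.
  apply: adde_ge0; first exact: bigmax_ge_id.
  apply: mule_ge0; first by rewrite lee_fin powR_ge0.
  exact: bigmax_ge_id.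
rewrite ge0_sume_distrr; last by move=> s _; exact: sume_ge0.
rewrite big_nat [leRHS]big_nat; apply: lee_sum => s sm.
rewrite ge0_sume_distrr//.
rewrite big_nat [leRHS]big_nat; apply: lee_sum => t tn.
have cc : c (s + t).-1 <= c (s + t)%N by rewrite c_le// leq_pred.
apply: le_trans (level_tail P X q K m n s t _ _ eps (lam m n s t)
  hq X0 H2q sm tn (c_ge0 _) cc eps0 (lam0 m n s t sm tn)).
apply: lee_sum => k _; exact: measureU2.
Qed.
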